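(* Let $K\ge1$ and $m\ge2$ be integers, $n=mK$, and consider the Gierer–Meinhardt system on the cycle graph with $n$ nodes $$u_t=-u+\frac{u^2}{v},\qquad 0=D_v\,\mathcal L v-v+u^2,\qquad D_v>0.$$ For $D>0$ set $$\alpha_1(D)=1+\frac1{2D}-\sqrt{\frac1D+\frac1{4D^2}},\qquad \alpha_2(D)=1+\frac1{2D}+\sqrt{\frac1D+\frac1{4D^2}},$$ $$a(D)=\frac{\alpha_2-\alpha_1}{\alpha_2^m-\alpha_1^m},\qquad b(D)=\frac{\alpha_2^{m-1}-\alpha_1^{m-1}}{\alpha_2^m-\alpha_1^m},$$ and let $D_{v_c}>0$ satisfy $$2\big(1+2D_{v_c}-2D_{v_c}(a+b)\big)=1+2D_{v_c}+2D_{v_c}(a-b),$$ where $a=a(D_{v_c})$ and $b=b(D_{v_c})$. Then the symmetric $K$-spike solution is stable when $D_v<D_{v_c}$.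
   Context: On the cycle graph with nodes indexed by $\mathbb Z/n\mathbb Z$, $(\mathcal L v)(k)=v(k+1)+v(k-1)-2v(k)$. The symmetric $K$-spike solution is the steady state with $u_{mk}=v_{mk}=C_0$, $u_{mk+j}=0$, $v_{mk+j}=C_j$ for $k=1,\dots,K$ and $j=1,\dots,m-1$ (indices modulo $n$), where $$C_j=C_0\left(\frac{\alpha_2^m-1}{\alpha_2^m-\alpha_1^m}\alpha_1^j+\frac{1-\alpha_1^m}{\alpha_2^m-\alpha_1^m}\alpha_2^j\right),\quad C_0=1-2D_v\left(\frac{\alpha_2^m-1}{\alpha_2^m-\alpha_1^m}\alpha_1+\frac{1-\alpha_1^m}{\alpha_2^m-\alpha_1^m}\alpha_2-1\right),$$ with $\alpha_i=\alpha_i(D_v)$. Stability means linear stability: every $\lambda\in\mathbb C$ for which there is $(\phi,\psi)\neq(0,0)$ with $$\lambda\phi=-\phi+\frac{2u}{v}\phi-\frac{u^2}{v^2}\psi,\qquad 0=D_v\mathcal L\psi-\psi+2u\phi$$ (with $(u,v)$ the steady state) has negative real part. *)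

(* Defs.v *)
From HB Require Import structures.
From mathcomp Require Import all_boot all_order all_algebra.
From mathcomp Require Export reals.
From mathcomp Require Export complex.
From mathcomp Require Import zify ring lra.

Set Implicit Arguments.
Unset Strict Implicit.
Unset Printing Implicit Defensive.

Import Order.TTheory GRing.Theory Num.Theory.
Local Open Scope ring_scope.
Local Open Scope complex_scope.

(* The nodes Z/nZ of the cycle graph are the ordinals 'I_n, on which ordS and
   ord_pred are the maps k |-> k + 1 and k |-> k - 1 modulo n. *)
Definition laplacian (V : zmodType) (n : nat) (v : 'I_n -> V) (k : 'I_n) : V :=
  v (ordS k) + v (ord_pred k) - v k *+ 2.

Definition steady_state (R : realType) (n : nat) (D : R) (u v : 'I_n -> R) :
    Prop :=
  forall k : 'I_n,
    [/\ v k != 0,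
        0 = - u k + u k ^+ 2 / v k
      & 0 = D * laplacian v k - v k + u k ^+ 2].

Definition is_eigenvalue (R : realType) (n : nat) (D : R) (u v : 'I_n -> R)
    (lambda : R[i]) : Prop :=
  exists phi psi : {ffun 'I_n -> R[i]},
    [/\ (phi, psi) <> (0, 0),
        forall k, lambda * phi k =
          - phi k + 2 * (u k)%:C / (v k)%:C * phi k
          - (u k)%:C ^+ 2 / (v k)%:C ^+ 2 * psi k
      & forall k, 0 =
          D%:C * laplacian psi k - psi k + 2 * (u k)%:C * phi k].

Definition linearly_stable (R : realType) (n : nat) (D : R)
    (u v : 'I_n -> R) : Prop :=
  forall lambda : R[i], is_eigenvalue D u v lambda -> complex.Re lambda < 0.

Definition alpha1 (R : realType) (D : R) : R :=
  1 + 1 / (2 * D) - Num.sqrt (1 / D + 1 / (4 * D ^+ 2)).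

Definition alpha2 (R : realType) (D : R) : R :=
  1 + 1 / (2 * D) + Num.sqrt (1 / D + 1 / (4 * D ^+ 2)).

Definition coef_a (R : realType) (m : nat) (D : R) : R :=
  (alpha2 D - alpha1 D) / (alpha2 D ^+ m - alpha1 D ^+ m).

Definition coef_b (R : realType) (m : nat) (D : R) : R :=
  (alpha2 D ^+ (m - 1) - alpha1 D ^+ (m - 1)) /
  (alpha2 D ^+ m - alpha1 D ^+ m).

(* The ratio C_j / C_0. *)
Definition profile (R : realType) (m : nat) (D : R) (j : nat) : R :=
  (alpha2 D ^+ m - 1) / (alpha2 D ^+ m - alpha1 D ^+ m) * alpha1 D ^+ j +
  (1 - alpha1 D ^+ m) / (alpha2 D ^+ m - alpha1 D ^+ m) * alpha2 D ^+ j.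

Definition spike_height (R : realType) (m : nat) (D : R) : R :=
  1 - 2 * D * (profile m D 1 - 1).

(* The spikes sit at the nodes divisible by m; the node m * k + j with j < m
   is i = m * k + j mod m * K, for which i %% m = j. *)
Definition spike_u (R : realType) (K m : nat) (D : R) (i : 'I_(m * K)) : R :=
  if (m %| i)%N then spike_height m D else 0.

Definition spike_v (R : realType) (K m : nat) (D : R) (i : 'I_(m * K)) : R :=
  if (m %| i)%N then spike_height m D
  else spike_height m D * profile m D (i %% m)%N.

Section SpikeIsSteady.
Variables (R : realType) (D : R).
Hypothesis D_gt0 : 0 < D.
Let q1 := alpha1 D.
Let q2 := alpha2 D.

Let alphaM : q1 * q2 = 1.
Proof.
have h : 0 <= 1 / D + 1 / (4 * D ^+ 2).
  by rewrite addr_ge0 // divr_ge0 ?mulr_ge0 ?exprn_ge0 // ltW.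
have := sqr_sqrtr h; rewrite /q1 /q2 /alpha1 /alpha2.
set s := Num.sqrt _ => hs.
have -> : (1 + 1 / (2 * D) - s) * (1 + 1 / (2 * D) + s)
  = (1 + 1 / (2 * D)) ^+ 2 - s ^+ 2 by ring.
by rewrite hs; field; rewrite gt_eqF.
Qed.

Let alphaD : D * (q1 + q2 - 2) = 1.
Proof. by rewrite /q1 /q2 /alpha1 /alpha2; field; rewrite gt_eqF. Qed.

Let alpha2_gt1 : 1 < q2.
Proof.
have h : 0 < 1 / (2 * D) by rewrite divr_gt0 ?mulr_gt0.
rewrite /q2 /alpha2; set s := Num.sqrt _.
have : 0 <= s by exact: sqrtr_ge0.
lra.
Qed.

Let alpha1_gt0 : 0 < q1.
Proof. by rewrite -(pmulr_lgt0 _ (lt_trans ltr01 alpha2_gt1)) alphaM. Qed.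

Let alpha1_lt1 : q1 < 1.
Proof. by rewrite -alphaM ltr_pMr. Qed.

Let alpha_pow (m : nat) : (0 < m)%N -> 1 < q2 ^+ m /\ 0 < q1 ^+ m < 1.
Proof.
rewrite lt0n => m0.
by rewrite exprn_egt1 // exprn_gt0 // exprn_ilt1 // ltW.
Qed.

Let alpha_den (m : nat) : (0 < m)%N -> 0 < q2 ^+ m - q1 ^+ m.
Proof. by move=> /alpha_pow [? /andP[? ?]]; lra. Qed.

Let profile_gt0 m j : (0 < m)%N -> 0 < profile m D j.
Proof.
move=> m0; have [h2 /andP[h1 h1']] := alpha_pow m0.
have hd := alpha_den m0.
have q2p : 0 < q2 by apply: lt_trans alpha2_gt1.
by rewrite /profile -/q1 -/q2 addr_gt0 // mulr_gt0 ?exprn_gt0 // divr_gt0 //;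
   rewrite subr_gt0.
Qed.

Let profile0 m : (0 < m)%N -> profile m D 0 = 1.
Proof.
move=> m0; have /lt0r_neq0 hd := alpha_den m0.
by rewrite /profile -/q1 -/q2 !expr0; field.
Qed.

Let profilem m : (0 < m)%N -> profile m D m = 1.
Proof.
move=> m0; have /lt0r_neq0 hd := alpha_den m0.
by rewrite /profile -/q1 -/q2; field.
Qed.

Let profile_sym m : (0 < m)%N -> profile m D (m - 1) = profile m D 1.
Proof.
case: m => // m _; have := alpha_den (ltn0Sn m).
rewrite subSS subn0 /profile -/q1 -/q2 => /lt0r_neq0 hd.
rewrite -!(mulrAC _ _ (_^-1)) -!mulrDl !expr1; congr (_ / _).
have e : q1 ^+ m * q2 ^+ m = 1 by rewrite -exprMn alphaM expr1n.
rewrite !exprS; set x := q1 ^+ m in e *; set y := q2 ^+ m in e *.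
have -> : (q2 * y - 1) * x + (1 - q1 * x) * y
  = q2 * (x * y) - x + y - q1 * (x * y) by ring.
rewrite e.
have -> : (q2 * y - 1) * q1 + (1 - q1 * x) * q2
  = (q1 * q2) * y - q1 + q2 - (q1 * q2) * x by ring.
by rewrite alphaM; ring.
Qed.

Let profile_rec m j : (0 < m)%N ->
  D * (profile m D j.+2 + profile m D j - profile m D j.+1 *+ 2)
  = profile m D j.+1.
Proof.
move=> m0; rewrite /profile -/q1 -/q2; set A := _ / _; set B := _ / _.
rewrite !exprS; set x := q1 ^+ j; set y := q2 ^+ j.
have -> : D * (A * (q1 * (q1 * x)) + B * (q2 * (q2 * y)) + (A * x + B * y)
               - (A * (q1 * x) + B * (q2 * y)) *+ 2)
  = A * x * (D * (q1 + q2 - 2) * q1 - D * (q1 * q2 - 1))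
    + B * y * (D * (q1 + q2 - 2) * q2 - D * (q1 * q2 - 1)) by ring.
rewrite alphaD alphaM; ring.
Qed.

Let profile1_le1 m : (0 < m)%N -> profile m D 1 <= 1.
Proof.
case: m => // m _; have hd := alpha_den (ltn0Sn m).
rewrite /profile -/q1 -/q2 -!(mulrAC _ _ (_^-1)) -!mulrDl !expr1.
rewrite ler_pdivrMr // mul1r -subr_ge0 !exprS.
have e : q1 ^+ m * q2 ^+ m = 1 by rewrite -exprMn alphaM expr1n.
have x1 : q1 ^+ m <= 1 by rewrite exprn_ile1 // ltW.
have y1 : 1 <= q2 ^+ m by rewrite exprn_ege1 // ltW.
have x0 : 0 < q1 ^+ m by rewrite exprn_gt0.
set x := q1 ^+ m in e x0 x1 *; set y := q2 ^+ m in e y1 *.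
have -> : q2 * y - q1 * x - ((q2 * y - 1) * q1 + (1 - q1 * x) * q2)
  = (q2 - 1) * (y - 1) * (1 - q1 * x)
    + (q1 * q2 - 1) * (x * y - y) + (x * y - 1) * (1 - q1).
  by ring.
rewrite alphaM e !subrr !mul0r !addr0 !mulr_ge0 // ?subr_ge0 // ?(ltW alpha2_gt1) //.
by apply: mulr_ile1 => //; exact: ltW.
Qed.

Let spike_height_gt0 m : (0 < m)%N -> 0 < spike_height m D.
Proof.
move=> m0; rewrite /spike_height.
have : 0 <= 2 * D * (1 - profile m D 1).
  by rewrite mulr_ge0 ?subr_ge0 ?profile1_le1 // mulr_ge0 // ltW.
lra.
Qed.

Lemma spike_steady_state (K m : nat) : (1 <= K)%N -> (2 <= m)%N ->
  steady_state D (@spike_u R K m D) (@spike_v R K m D).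
Proof.
move=> K1 m2; have m0 : (0 < m)%N by apply: ltnW.
pose w j := spike_height m D * profile m D j.
have vE i : @spike_v R K m D i = w (i %% m)%N.
  rewrite /spike_v /w; case: ifP => // /eqP ->.
  by rewrite profile0 ?mulr1.
have w0 : w 0%N = spike_height m D by rewrite /w profile0 ?mulr1.
have wm : w m = w 0%N by rewrite /w profilem // profile0.
have w_gt0 j : 0 < w j by rewrite mulr_gt0 ?spike_height_gt0 ?profile_gt0.
have vS i : @spike_v R K m D (ordS i) = w (i %% m).+1.
  rewrite vE /= modn_dvdm ?dvdn_mulr // -addn1 -modnDml addn1.
  have := ltn_pmod i m0; rewrite leq_eqVlt => /orP[/eqP -> | h].
    by rewrite modnn wm.
  by rewrite modn_small.
have vP i : @spike_v R K m D (ord_pred i) =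
    w (if (i %% m)%N is j.+1 then j else m.-1).
  rewrite vE /= modn_dvdm ?dvdn_mulr //; congr w.
  have -> : ((i + m * K).-1 = i + m.-1 + K.-1 * m)%N.
    have : (m * K = m + K.-1 * m)%N by rewrite -mulSn prednK // mulnC.
    lia.
  rewrite addnC modnMDl -modnDml; case: (_ %% _)%N (ltn_pmod i m0) => [|j] hj.
    by rewrite add0n modn_small // prednK.
  by rewrite addSnnS prednK // modnDr modn_small // ltnW.
move=> i; split; first by rewrite vE gt_eqF.
  rewrite /spike_u /spike_v; case: ifP => h; last by rewrite expr0n /= mul0r oppr0 addr0.
  by field; rewrite gt_eqF ?spike_height_gt0.
rewrite /laplacian vS vP vE /spike_u /dvdn.
case: (i %% m)%N => [|j] /=; last first.
  rewrite expr0n /= addr0 /w -mulrnAr -mulrDr -mulrBr mulrCA profile_rec //.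
  by rewrite subrr.
rewrite /w -subn1 profile_sym // profile0 // mulr1.
set C := spike_height m D; set p := profile m D 1.
have -> : C ^+ 2 = C * (1 - 2 * D * (p - 1)) by [].
ring.
Qed.

End SpikeIsSteady.

(* Main.v *)
Require Import Defs.
From HB Require Import structures.
From mathcomp Require Import all_boot all_order all_algebra.
From mathcomp Require Import zify ring lra.
Import Order.TTheory GRing.Theory Num.Theory.
Local Open Scope ring_scope.
Local Open Scope complex_scope.

(** Let D stand for D_v. Off the spikes u = 0, so an eigenvector with
    lambda <> -1 has phi = 0 there and D L psi = psi; at a spike u = v = C_0
    gives psi = mu phi with mu = 1 - lambda. It has to be shown that Re mu > 1.

    Take a node k at which |psi| is maximal. By the maximum principle for
    D L psi = psi ([max_principle]) and because the eigenvector is nonzero, k is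
    a spike and psi(k) <> 0. Between two consecutive spikes psi satisfies a
    linear recurrence of order two with trace t = 2 + 1/D, so that
    psi(k + 1) = a psi(k + m) + b psi(k), and likewise on the other side
    ([spike_neighbour]). Inserted in the equation at k and multiplied by mu,
    this reads
      (2 C_0 - p mu) psi(k) = - D a mu (psi(k + m) + psi(k - m)),
      p = 1 + 2 D - 2 D b,
    whence |2 C_0 - p mu| <= r |mu| with r = 2 D a, by maximality of |psi(k)|.
    Since p - r = C_0 > 0, this forces Re mu >= 2 C_0 / (p + r)
    ([Re_gt1_of_disc] is the form of this that is needed), and it remains to see
    that 2 C_0 > p + r, that is t > 2 b + 6 a. At the critical diffusivity
    equality holds. The quantities a = 1 / s_m and b = s_{m-1} / s_m, where
    s_j = (alpha_2^j - alpha_1^j) / (alpha_2 - alpha_1) is the Chebyshev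
    sequence [cheb t], are nonincreasing in t >= 2 ([cheb_le],
    [cheb_ratio_le]), and t decreases strictly with D; so the strict
    inequality holds below the critical value ([subcritical]). *)

(** * The Chebyshev recurrence *)

(** The sequence with s_0 = 0, s_1 = 1 and s_{j+2} = t s_{j+1} - s_j, that is
    s_j = U_{j-1}(t/2) for the Chebyshev polynomials U of the second kind. The
    ring is left general so that the sequence can be moved from the reals to
    the complex numbers. *)
Fixpoint cheb (R : pzRingType) (t : R) (j : nat) : R :=
  match j with
  | 0 => 0
  | j'.+1 => match j' with
             | 0 => 1
             | j''.+1 => t * cheb R t j' - cheb R t j''
             end
  end.
Arguments cheb {R} t j.

Lemma chebSS (R : pzRingType) (t : R) j :
  cheb t j.+2 = t * cheb t j.+1 - cheb t j.
Proof. by []. Qed.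

Lemma rmorph_cheb (R S : pzRingType) (f : {rmorphism R -> S}) (t : R) j :
  f (cheb t j) = cheb (f t) j.
Proof.
suff [] : f (cheb t j) = cheb (f t) j /\ f (cheb t j.+1) = cheb (f t) j.+1 by [].
elim: j => [|j [IH0 IH1]]; first by rewrite /= rmorph0 rmorph1.
by split=> //; rewrite !chebSS rmorphB rmorphM IH0 IH1.
Qed.

(** A solution y of the recurrence along the orbit x, f x, f (f x), ... is
    determined by its first two values. Only the indices strictly between 0 and
    m are constrained. Taking f to be either shift of the cycle covers both
    directions away from a spike. *)
Lemma cheb_recurrence {R : comPzRingType} {T : Type} {f g : T -> T}
    (fK : cancel f g) {y : T -> R} {t : R} {x : T} {m : nat} :
    (forall j, (0 < j < m)%N ->
       y (f (iter j f x)) + y (g (iter j f x)) = t * y (iter j f x)) ->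
  (0 < m)%N -> y (iter m f x) = cheb t m * y (f x) - cheb t m.-1 * y x.
Proof.
case: m => // m; elim/ltn_ind: m => -[|[|m]] IH H _.
- by rewrite /= mul1r mul0r subr0.
- have := H 1%N isT; rewrite /= fK => E.
  by rewrite (_ : y (f (f x)) = t * y (f x) - y x); [ring | rewrite -E; ring].
- have := H m.+2; rewrite ltnS leqnn => /(_ isT); rewrite iterS fK => E.
  have {}E : y (iter m.+3 f x) = t * y (iter m.+2 f x) - y (iter m.+1 f x).
    by rewrite -E /=; ring.
  rewrite E (IH m.+1) // ?(IH m) //.
  + by rewrite [in RHS]succnK !(chebSS _ t m.+1) !(chebSS _ t m) /=; ring.
  + by move=> j /andP[j0 jm]; apply: H; rewrite j0; lia.
  + by move=> j /andP[j0 jm]; apply: H; rewrite j0; lia.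
Qed.

Lemma cheb_incr {R : realDomainType} (t : R) j :
  2 <= t -> 0 <= cheb t j < cheb t j.+1.
Proof.
move=> t2; elim: j => [|j /andP[h0 h1]]; first by rewrite /= lexx ltr01.
rewrite chebSS; set x := cheb t j in h0 h1 *; set y := cheb t j.+1 in h1 *.
by apply/andP; split; nra.
Qed.

Lemma cheb_gt0 {R : realDomainType} (t : R) j : 2 <= t -> 0 < cheb t j.+1.
Proof. by move=> /(cheb_incr t j)/andP[]; exact: le_lt_trans. Qed.

(** The ratio s_j / s_{j+1} is nonincreasing in t, in cross-multiplied form. *)
Lemma cheb_ratio_le {R : realDomainType} (t t' : R) j : 2 <= t -> t <= t' ->
  cheb t' j * cheb t j.+1 <= cheb t j * cheb t' j.+1.
Proof.
move=> t2 tt'; elim: j => [|j IH]; first by rewrite !mul0r.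
have t2' := le_trans t2 tt'.
have := cheb_gt0 t j t2; have := cheb_gt0 t' j t2'.
rewrite !chebSS => h' h.
rewrite -subr_ge0.
rewrite (_ : _ - _ = (t' - t) * (cheb t' j.+1 * cheb t j.+1) +
  (cheb t j * cheb t' j.+1 - cheb t' j * cheb t j.+1)); last by ring.
by rewrite addr_ge0 ?subr_ge0 // mulr_ge0 ?subr_ge0 // mulr_ge0 // ltW.
Qed.

Lemma cheb_le {R : realDomainType} (t t' : R) j : 2 <= t -> t <= t' ->
  cheb t j <= cheb t' j.
Proof.
move=> t2 tt'; elim: j => [//|[//|j] IH].
have h := cheb_gt0 t j t2.
rewrite -(ler_pM2l h).
apply: le_trans (cheb_ratio_le t t' j.+1 t2 tt').
by rewrite ler_wpM2r // ltW // cheb_gt0.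
Qed.

(** * The coefficients a and b, the spike height and the critical diffusivity *)

Lemma alpha_mul {R : realType} {D : R} : 0 < D ->
  alpha1 D * alpha2 D = 1.
Proof.
move=> D_gt0; have h : 0 <= 1 / D + 1 / (4 * D ^+ 2).
  by rewrite addr_ge0 // divr_ge0 ?mulr_ge0 ?exprn_ge0 // ltW.
rewrite /alpha1 /alpha2 -subr_sqr sqr_sqrtr //.
by field; rewrite gt_eqF.
Qed.

Lemma alpha_add {R : realType} {D : R} : 0 < D ->
  alpha1 D + alpha2 D = 2 + D^-1.
Proof. by move=> D_gt0; rewrite /alpha1 /alpha2; field; rewrite gt_eqF. Qed.

Lemma alpha_lt {R : realType} {D : R} : 0 < D ->
  alpha1 D < alpha2 D.
Proof.
move=> D_gt0; rewrite /alpha1 /alpha2; set s := Num.sqrt _.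
have : 0 < s.
  by rewrite sqrtr_gt0 addr_gt0 // divr_gt0 ?mulr_gt0 ?exprn_gt0.
lra.
Qed.

(** As alpha_1 and alpha_2 are the roots of X^2 - t X + 1 with t = 2 + 1/D, this
    is the Binet formula for [cheb t]. *)
Lemma alpha_expB {R : realType} {D : R} (j : nat) : 0 < D ->
  alpha2 D ^+ j - alpha1 D ^+ j =
  (alpha2 D - alpha1 D) * cheb (2 + D^-1) j.
Proof.
move=> D_gt0; rewrite -(alpha_add D_gt0); have := alpha_mul D_gt0.
set p := alpha1 D; set q := alpha2 D => pq.
suff [] : q ^+ j - p ^+ j = (q - p) * cheb (p + q) j /\
  q ^+ j.+1 - p ^+ j.+1 = (q - p) * cheb (p + q) j.+1 by [].
elim: j => [|j [IH0 IH1]]; first by rewrite /= !expr0 !expr1 subrr mulr0 mulr1.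
split=> //; rewrite chebSS mulrBr mulrCA -IH0 -IH1 !exprS.
(* The coefficient 1 of s_j in the recurrence is the product of the roots. *)
by rewrite -[in RHS](mul1r (q ^+ j - p ^+ j)) -pq; ring.
Qed.

Lemma two_le_trace {R : realType} {D : R} : 0 < D ->
  2 <= 2 + D^-1.
Proof. by move=> D_gt0; rewrite lerDl invr_ge0 ltW. Qed.

Lemma coef_aE {R : realType} {D : R} (m : nat) : 0 < D ->
  coef_a m D = (cheb (2 + D^-1) m)^-1.
Proof.
move=> D_gt0; have dq : alpha2 D - alpha1 D != 0 by rewrite subr_eq0 gt_eqF ?alpha_lt.
by rewrite /coef_a (alpha_expB m) // invfM mulrA divff // mul1r.
Qed.

Lemma coef_bE {R : realType} {D : R} (m : nat) : 0 < D ->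
  coef_b m D = cheb (2 + D^-1) m.-1 / cheb (2 + D^-1) m.
Proof.
move=> D_gt0; have dq : alpha2 D - alpha1 D != 0 by rewrite subr_eq0 gt_eqF ?alpha_lt.
by rewrite /coef_b subn1 (alpha_expB m) // (alpha_expB m.-1) // -mulf_div divff // mul1r.
Qed.

(** The formula rests on C_1 / C_0 = a + b. *)
Lemma spike_heightE {R : realType} {D : R} (m : nat) : 0 < D ->
  (0 < m)%N ->
  spike_height m D = 1 + 2 * D - 2 * D * (coef_a m D + coef_b m D).
Proof.
move=> D_gt0; case: m => // m _.
have dn0 : alpha2 D ^+ m.+1 - alpha1 D ^+ m.+1 != 0.
  rewrite (alpha_expB m.+1) // mulf_neq0 ?subr_eq0 ?gt_eqF ?alpha_lt //.
  exact/cheb_gt0/(two_le_trace D_gt0).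
suff E : profile m.+1 D 1 = coef_a m.+1 D + coef_b m.+1 D.
  by rewrite /spike_height E; ring.
move: dn0; have := alpha_mul D_gt0; rewrite /profile /coef_a /coef_b subn1 succnK.
rewrite !exprS !expr0 !mulr1.
set p := alpha1 D; set q := alpha2 D => pq dn0.
rewrite -mulrAC -[(1 - _) / _ * q]mulrAC -!mulrDl; congr (_ / _).
set x := p ^+ m; set y := q ^+ m.
rewrite (_ : (q * y - 1) * p + (1 - p * x) * q
   = (p * q) * y - p + q - (p * q) * x); last by ring.
by rewrite pq; ring.
Qed.

(** Below the critical diffusivity the equation defining it, which amounts to
    2 b + 6 a = 2 + 1/D, becomes a strict inequality. *)
Lemma subcritical {R : realType} {m : nat} {Dvc Dv : R} : (2 <= m)%N ->
    2 * (1 + 2 * Dvc - 2 * Dvc * (coef_a m Dvc + coef_b m Dvc)) =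
      1 + 2 * Dvc + 2 * Dvc * (coef_a m Dvc - coef_b m Dvc) ->
    0 < Dv -> Dv < Dvc ->
  2 * coef_b m Dv + 6 * coef_a m Dv < 2 + Dv^-1.
Proof.
case: m => [//|m _ hcrit D0 lt].
have Dc0 := lt_trans D0 lt.
have tt : 2 + Dvc^-1 < 2 + Dv^-1 by rewrite ltrD2l ltf_pV2.
have t2 := two_le_trace Dc0.
have crit : 2 * coef_b m.+1 Dvc + 6 * coef_a m.+1 Dvc = 2 + Dvc^-1.
  have /eqP : Dvc * (2 * coef_b m.+1 Dvc + 6 * coef_a m.+1 Dvc - 2 - Dvc^-1) = 0.
    by rewrite !mulrBr divff ?gt_eqF //; lra.
  by rewrite mulf_eq0 gt_eqF //= => /eqP; lra.
apply: le_lt_trans tt; rewrite -crit !coef_aE // !coef_bE // succnK.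
have t2' := two_le_trace D0.
have tt' : 2 + Dvc^-1 <= 2 + Dv^-1 by rewrite lerD2l lef_pV2 // ltW.
have h := cheb_gt0 _ m t2; have h' := cheb_gt0 _ m t2'.
apply: lerD; rewrite ler_pM2l //.
  by rewrite ler_pdivrMr // mulrAC ler_pdivlMr //; exact: cheb_ratio_le.
by rewrite lef_pV2 //; exact: cheb_le.
Qed.

(** * Complex estimates *)

(** When mu <> 0, the hypothesis says that h / mu lies in the disc of centre p
    and radius r; inversion sends this disc, which avoids 0, into the
    half-plane of complex numbers with real part at least 1 / (p + r). *)
Lemma Re_gt1_of_disc {R : realType} {p r h : R} {mu : R[i]} :
    0 <= r -> r < p -> p + r < h ->
    `|h%:C - p%:C * mu| <= r%:C * `|mu| ->
  1 < complex.Re mu.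
Proof.
move=> r0 rp prh.
rewrite -ler_sqr ?nnegrE ?mulr_ge0 ?normr_ge0 ?ler0c // exprMn.
rewrite -!add_Re2_Im2 -rmorphXn -rmorphM lecR.
case: mu => s y; rewrite /= !mul0r !addr0 !sub0r ?subr0 ?add0r.
move=> le; rewrite ltNge; apply/negP => s1.
have {}le : (h - p * s) ^+ 2 <= (r * s) ^+ 2.
  have : 0 <= (p ^+ 2 - r ^+ 2) * y ^+ 2.
    by rewrite mulr_ge0 ?sqr_ge0 // subr_ge0 ler_sqr ?nnegrE; lra.
  nra.
(* Both h - p s - r s and h - p s + r s are positive when s <= 1. *)
suff : 0 < (h - p * s - r * s) * (h - p * s + r * s) by lra.
by have [s0|s0] := leP 0 s; rewrite mulr_gt0 //; nra.
Qed.

(** * Moving along the cycle *)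

Lemma iter_ordS_modn (K m j : nat) (k : 'I_(m * K)) :
  (iter j (@ordS _) k = k + j %[mod m])%N.
Proof.
elim: j => [|j IH]; first by rewrite addn0.
by rewrite iterS /= modn_dvdm ?dvdn_mulr // -addn1 -modnDml IH modnDml addn1 addnS.
Qed.

Lemma dvdn_iter_ordS {K m : nat} (j : nat) {k : 'I_(m * K)} : (m %| k)%N ->
  (m %| iter j (@ordS _) k)%N = (m %| j)%N.
Proof. by move=> mk; rewrite /dvdn iter_ordS_modn -/(dvdn _ _) dvdn_addr. Qed.

Lemma dvdn_iter_ord_pred {K m : nat} (j : nat) {k : 'I_(m * K)} : (m %| k)%N ->
  (m %| iter j (@ord_pred _) k)%N = (m %| j)%N.
Proof.
move=> mk.
have := iter_ordS_modn _ _ j (iter j (@ord_pred _) k).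
(* Going back by j steps and forth again returns to k. *)
rewrite (_ : iter j _ _ = k); last first.
  by elim: j => //= j IH; rewrite -iterS iterSr ord_predK.
move=> E; have {E} := congr1 (eq_op^~ 0%N) E.
rewrite -!/(dvdn _ _) mk => /esym E; apply/idP/idP => h.
  by rewrite -(dvdn_addr _ h).
by rewrite -(dvdn_addl _ h).
Qed.

(** * The equation for psi off the spikes *)

(** Here (1 + 2 D) |psi(k)| <= 2 D |psi(k)| by maximality. *)
Lemma max_principle {R : realType} {n : nat} {D : R} {psi : 'I_n -> R[i]} {k} :
    0 < D -> 0 = D%:C * laplacian psi k - psi k ->
    (forall i, `|psi i| <= `|psi k|) ->
  psi k = 0.
Proof.
move=> D0 E H; have Dc : 0 <= D%:C by rewrite ler0c ltW.
have {}E : (1 + 2 * D)%:C * psi k = D%:C * (psi (ordS k) + psi (ord_pred k)).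
  apply/eqP; rewrite -subr_eq0 -oppr_eq0 [X in _ == X]E /laplacian.
  by rewrite rmorphD rmorphM rmorph1 rmorph_nat; apply/eqP; ring.
have : `|(1 + 2 * D)%:C * psi k| <= (2 * D)%:C * `|psi k|.
  rewrite E normrM (ger0_norm Dc) rmorphM rmorph_nat (mulrC 2) -mulrA ler_wpM2l //.
  by rewrite (le_trans (ler_normD _ _)) // mulr_natl mulr2n lerD.
rewrite normrM ger0_norm; last by rewrite ler0c; lra.
rewrite rmorphD rmorph1 mulrDl mul1r gerDr normr_le0.
by move/eqP.
Qed.

(** The value next to the node k, in terms of those at k and at the next spike,
    m steps further in the direction f. *)
Lemma spike_neighbour {R : realType} {T : Type} {m : nat} {D : R}
    {f g : T -> T} {psi : T -> R[i]} {k : T} :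
    (0 < m)%N -> 0 < D -> cancel f g ->
    (forall j, (0 < j < m)%N ->
       0 = D%:C * (psi (f (iter j f k)) + psi (g (iter j f k))
                   - psi (iter j f k) *+ 2) - psi (iter j f k)) ->
  psi (f k) = (coef_a m D)%:C * psi (iter m f k) + (coef_b m D)%:C * psi k.
Proof.
move=> m0 D0 fK H.
have Dc : D%:C != 0 by rewrite fmorph_eq0 gt_eqF.
have Hr j : (0 < j < m)%N -> psi (f (iter j f k)) + psi (g (iter j f k)) =
    (2 + D^-1)%:C * psi (iter j f k).
  move=> /H; set x := psi (f _); set y := psi (g _); set z := psi _ => E.
  have DE : D * (2 + D^-1) = 2 * D + 1 by field; rewrite gt_eqF.
  apply: (mulfI Dc); rewrite mulrA -rmorphM DE.
  apply/eqP; rewrite -subr_eq0 [X in _ == X]E rmorphD rmorphM rmorph1 rmorph_nat.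
  by apply/eqP; ring.
rewrite (cheb_recurrence fK Hr m0) -!rmorph_cheb coef_aE // coef_bE //.
have : (cheb (2 + D^-1) m)%:C != 0.
  by case: m m0 {H Hr} => // m _; rewrite fmorph_eq0 gt_eqF // cheb_gt0 // two_le_trace.
rewrite rmorphM fmorphV => c0.
by field.
Qed.

(** * Stability of the spike solution *)

Theorem theorem3p1 (R : realType) (K m : nat) (hK : (1 <= K)%N)
    (hm : (2 <= m)%N) (Dvc : R) (hDvc : 0 < Dvc)
    (hcrit : 2 * (1 + 2 * Dvc - 2 * Dvc * (coef_a m Dvc + coef_b m Dvc)) =
             1 + 2 * Dvc + 2 * Dvc * (coef_a m Dvc - coef_b m Dvc))
    (Dv : R) (hDv : 0 < Dv) (hlt : Dv < Dvc) :
  linearly_stable Dv (@spike_u R K m Dv) (@spike_v R K m Dv).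
Proof.
move=> lambda [phi [psi [nz Hphi Hpsi]]].
have m0 : (0 < m)%N := ltnW hm.
set a := coef_a m Dv; set b := coef_b m Dv; set h := spike_height m Dv.
(* 2 C_0 - (p + r) in the notation used below. *)
have crit : 0 < 1 + 2 * Dv - 2 * Dv * b - 6 * Dv * a.
  have := subcritical hm hcrit hDv hlt; rewrite -(ltr_pM2l hDv).
  by rewrite !mulrDr divff ?gt_eqF // -/a -/b; lra.
have a0 : 0 < a.
  rewrite /a coef_aE // invr_gt0; case: (m) m0 => // j _.
  exact/cheb_gt0/(two_le_trace hDv).
have hE : h = 1 + 2 * Dv - 2 * Dv * (a + b) by exact: spike_heightE.
have Da0 : 0 < Dv * a by rewrite mulr_gt0.
have h0 : 0 < h by rewrite hE; lra.
have hc0 : h%:C != 0 by rewrite fmorph_eq0 gt_eqF.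
have [->|lam] := eqVneq lambda (-1); first by rewrite /= ltrN10.
have Hoff (i : 'I_(m * K)) : ~~ (m %| i)%N -> phi i = 0.
  move=> /negbTE hi; have := Hphi i; rewrite /spike_u hi rmorph0 expr0n /=.
  rewrite mulr0 !mul0r subr0 addr0.
  move=> /eqP; rewrite -subr_eq0 opprK -{2}[phi i]mul1r -mulrDl mulf_eq0.
  by rewrite addr_eq0 (negbTE lam) => /eqP.
have Hpoff (i : 'I_(m * K)) : ~~ (m %| i)%N -> 0 = Dv%:C * laplacian psi i - psi i.
  by move=> hi; rewrite {1}(Hpsi i) (Hoff i hi) mulr0 addr0.
have Hon (i : 'I_(m * K)) : (m %| i)%N -> (1 - lambda) * phi i = psi i.
  move=> hi; have := Hphi i; rewrite /spike_u /spike_v hi -/h.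
  by rewrite mulrBl mul1r -(mulrA 2) !divff ?expf_neq0 // => ->; ring.
have Hpon (i : 'I_(m * K)) : (m %| i)%N ->
    0 = Dv%:C * laplacian psi i - psi i + 2 * h%:C * phi i.
  by move=> hi; have := Hpsi i; rewrite /spike_u hi.
have n0 : (0 < m * K)%N by rewrite muln_gt0 m0.
(* The complex order is partial, but moduli are real, hence comparable. *)
have [k _ Hk] := real_arg_maxP (i0 := Ordinal n0) (P := xpredT)
  (F := fun i => `|psi i|) isT (fun i _ => normr_real _).
have {}Hk (i : 'I_(m * K)) : `|psi i| <= `|psi k| by exact: Hk.
have psik : psi k != 0.
  apply/eqP => E; apply: nz.
  have psi0 (i : 'I_(m * K)) : psi i = 0.
    by apply/eqP; rewrite -normr_le0 (le_trans (Hk i)) // E normr0.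
  congr pair; apply/ffunP => i; rewrite !ffunE ?psi0 //.
  have [hi|/Hoff//] := boolP (m %| i)%N.
  have := Hpon i hi; rewrite /laplacian !psi0 mul0rn !addr0 !subr0 mulr0 add0r.
  by move/esym/eqP; rewrite !mulf_eq0 pnatr_eq0 (negbTE hc0) /= => /eqP.
(* The maximum principle rules out a node that is not a spike. *)
have mk : (m %| k)%N.
  apply: contraNT psik => /Hpoff E; apply/eqP; exact: max_principle hDv E Hk.
have nd j : (0 < j < m)%N -> ~~ (m %| j)%N.
  by move=> /andP[j0 jm]; rewrite gtnNdvd.
have Hfwd j : (0 < j < m)%N -> 0 = Dv%:C *
    (psi (ordS (iter j (@ordS _) k)) + psi (ord_pred (iter j (@ordS _) k))
     - psi (iter j (@ordS _) k) *+ 2) - psi (iter j (@ordS _) k).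
  by move=> hj; apply: Hpoff; rewrite dvdn_iter_ordS // nd.
have Hbwd j : (0 < j < m)%N -> 0 = Dv%:C *
    (psi (ord_pred (iter j (@ord_pred _) k)) + psi (ordS (iter j (@ord_pred _) k))
     - psi (iter j (@ord_pred _) k) *+ 2) - psi (iter j (@ord_pred _) k).
  move=> hj; rewrite (addrC (psi (ord_pred _))); apply: Hpoff.
  by rewrite dvdn_iter_ord_pred // nd.
have fwd := spike_neighbour m0 hDv (@ordSK _) Hfwd.
have bwd := spike_neighbour m0 hDv (@ord_predK _) Hbwd.
suff : 1 < complex.Re (1 - lambda).
  by case: (lambda) => x y /=; lra.
set p := 1 + 2 * Dv - 2 * Dv * b.
have r0 : 0 <= 2 * Dv * a by lra.
have rp : 2 * Dv * a < p by rewrite /p; lra.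
have prh : p + 2 * Dv * a < 2 * h by rewrite hE /p; lra.
apply: Re_gt1_of_disc r0 rp prh _.
have psi0 : 0 < `|psi k| by rewrite normr_gt0.
rewrite -(ler_pM2r psi0) -normrM.
set y := psi (iter m (@ordS _) k) in fwd; set z := psi (iter m _ k) in bwd.
have -> : ((2 * h)%:C - p%:C * (1 - lambda)) * psi k =
    - ((Dv * a)%:C * (1 - lambda) * (y + z)).
  (* The difference of the two sides is mu times the equation at k. *)
  have := Hpon k mk; rewrite /laplacian fwd bwd -/a -/b -(Hon k mk) /p.
  (* The local definitions are made opaque: a, b, C_0 are mere letters here. *)
  move: (a) (b) (h) => a' b' h' E.
  apply/eqP; rewrite -subr_eq0 -(mulr0 (1 - lambda)) [X in _ == _ * X]E.
  rewrite !(rmorphD, rmorphN, rmorphM, rmorph1, rmorph_nat) /=.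
  by apply/eqP; ring.
have Dac : 0 <= (Dv * a)%:C by rewrite ler0c ltW.
rewrite normrN !normrM (ger0_norm Dac).
have -> : (2 * Dv * a)%:C * `|1 - lambda| * `|psi k| =
    (Dv * a)%:C * `|1 - lambda| * (2 * `|psi k|).
  by rewrite -(mulrA 2 Dv a) (rmorphM _ 2) rmorph_nat; ring.
apply: ler_wpM2l; first by rewrite mulr_ge0.
by rewrite (le_trans (ler_normD _ _)) // mulr_natl mulr2n lerD // ?/y ?/z Hk.
Qed.
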